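(* Let $H$ be a real Hilbert space, let $A\colon H\to 2^{H}$ be maximally monotone, and let $B\colon H\to H$ be monotone. Suppose that $\operatorname{zer}(A+B)\neq\varnothing$ and that $B$ is $\beta$-Lipschitzian for some $\beta\in\,]0,+\infty[$. Let $(a_n)_{n\in\mathbb N}$, $(b_n)_{n\in\mathbb N}$, and $(c_n)_{n\in\mathbb N}$ be sequences in $H$ such that $\sum_{n\in\mathbb N}\|a_n\|<+\infty$, $\sum_{n\in\mathbb N}\|b_n\|<+\infty$, and $\sum_{n\in\mathbb N}\|c_n\|<+\infty$. Let $x_0\in H$, let $\varepsilon\in\,]0,1/(\beta+1)[$, let $(\gamma_n)_{n\in\mathbb N}$ be a sequence in $[\varepsilon,(1-\varepsilon)/\beta]$, and set, for every $n\in\mathbb N$, $$y_n=x_n-\gamma_n(Bx_n+a_n),\quad p_n=J_{\gamma_nA}\,y_n+b_n,\quad q_n=p_n-\gamma_n(Bp_n+c_n),\quad x_{n+1}=x_n-y_n+q_n.$$ Then the following hold for some $\overline{x}\in\operatorname{zer}(A+B)$. (i) $\sum_{n\in\mathbb N}\|x_n-p_n\|^2<+\infty$ and $\sum_{n\in\mathbb N}\|y_n-q_n\|^2<+\infty$. (ii) $x_n\rightharpoonup\overline{x}$ and $p_n\rightharpoonup\overline{x}$. (iii) Suppose that one of the following is satisfied: (a) $A+B$ is demiregular at $\overline{x}$; (b) $A$ or $B$ is uniformly monotone at $\overline{x}$; (c) $\operatorname{int}\operatorname{zer}(A+B)\neq\varnothing$. Then $x_n\to\overline{x}$ and $p_n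\to\overline{x}$.
   Context: $\rightharpoonup$ and $\to$ denote weak and strong convergence. For a set-valued operator $M\colon H\to 2^H$: $\operatorname{dom}M=\{x\in H\mid Mx\neq\varnothing\}$, $\operatorname{gra}M=\{(x,u)\in H\times H\mid u\in Mx\}$, $\operatorname{zer}M=\{x\in H\mid 0\in Mx\}$, and the resolvent of $M$ is $J_M=(\operatorname{Id}+M)^{-1}$ (single-valued and defined on all of $H$ when $M$ is maximally monotone). $M$ is monotone if $\langle x-y\mid u-v\rangle\geq 0$ for all $(x,u),(y,v)\in\operatorname{gra}M$, and maximally monotone if no monotone operator has a graph properly containing $\operatorname{gra}M$. $M$ is demiregular at $x\in\operatorname{dom}M$ if, for every sequence $((x_n,u_n))_{n\in\mathbb N}$ in $\operatorname{gra}M$ and every $u\in Mx$ such that $x_n\rightharpoonup x$ and $u_n\to u$, we have $x_n\to x$. $M$ is uniformly monotone at $x\in\operatorname{dom}M$ if there exists an increasing function $\phi\colon[0,+\infty[\to[0,+\infty]$ that vanishes only at $0$ such that, for every $u\in Mx$ and every $(y,v)\in\operatorname{gra}M$, $\langle x-y\mid u-v\rangle\geq\phi(\|x-y\|)$. *)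

(* Defs.v *)
From HB Require Import structures.
From mathcomp Require Import all_boot all_order all_algebra.
From mathcomp Require Import all_classical all_reals all_analysis.

Set Implicit Arguments.
Unset Strict Implicit.
Unset Printing Implicit Defensive.

Import Order.TTheory GRing.Theory Num.Theory.
Import numFieldNormedType.Exports.

Local Open Scope classical_set_scope.
Local Open Scope ring_scope.

HB.mixin Record CompleteNormedModule_isHilbert (R : realType) H
    of CompleteNormedModule R H := {
  inner : {dot H for idfun} ;
  inner_norm : forall x : H, inner x x = `|x| ^+ 2
}.

#[short(type="hilbertType")]
HB.structure Definition Hilbert (R : realType) :=
  {H of CompleteNormedModule R H & CompleteNormedModule_isHilbert R H}.

Section Operators.
Variables (R : realType) (H : hilbertType R).
Implicit Types (M N : H -> set H) (x y u v : H).

Local Notation "''[' u , v ]" := (inner u%R v%R) : ring_scope.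

Definition weak_cvg (x_ : nat -> H) x :=
  forall v, '[x_ n, v] @[n --> \oo] --> '[x, v].

Definition op_fun (f : H -> H) : H -> set H := fun x => [set f x].

Definition op_add M N : H -> set H :=
  fun x => [set u + v | u in M x & v in N x].

Definition op_scale (g : R) M : H -> set H := fun x => [set g *: u | u in M x].

Definition op_inv M : H -> set H := fun u => [set x | M x u].

Definition gra M : set (H * H) := [set xu | M xu.1 xu.2].
Definition dom M : set H := [set x | M x !=set0].
Definition zer M : set H := [set x | M x 0].

Definition op_monotone M := forall x u y v,
  gra M (x, u) -> gra M (y, v) -> 0 <= '[x - y, u - v].

Definition op_max_monotone M :=
  op_monotone M /\ ~ exists N, op_monotone N /\ gra M `<` gra N.

(* The point of (Id + M)^-1 y. When M is maximally monotone, (Id + M)^-1 y is a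
   singleton for every y, so neither the choice nor the default value 0 made by
   xget matters. *)
Definition resolvent M : H -> H :=
  fun y => xget 0 (op_inv (op_add (op_fun idfun) M) y).

Definition demiregular M x := dom M x /\
  forall (x_ u_ : nat -> H) u, (forall n, gra M (x_ n, u_ n)) -> M x u ->
    weak_cvg x_ x -> u_ n @[n --> \oo] --> u -> x_ n @[n --> \oo] --> x.

(* "Increasing" is meant in the wide sense, as usual in convex analysis, and
   only the values of phi on [0, +oo[ matter. *)
Definition uniformly_monotone M x := dom M x /\
  exists phi : R -> \bar R,
    [/\ forall s : R, 0 <= s -> (0 <= phi s)%E,
        forall s t : R, 0 <= s -> s <= t -> (phi s <= phi t)%E,
        forall s : R, 0 <= s -> (phi s = 0%E <-> s = 0) &
        forall u y v, M x u -> gra M (y, v) ->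
          (phi `|x - y|%R <= '[x - y, u - v]%R%:E)%E].

End Operators.

(* Main.v *)
Require Import Defs.
From HB Require Import structures.
From mathcomp Require Import all_boot all_order all_algebra.
From mathcomp Require Import all_classical all_reals all_analysis.
From mathcomp Require Import ring lra.

(** Write [Z] for the zeros of [A + B]. If the three error sequences vanish,
    one iteration sends [x] to [x - r], where [p] is the resolvent step
    starting from [x - g *: B x] and
    [r = (x - g *: B x) - (p - g *: B p)]. Then [g^-1 *: r] belongs to
    [(A + B) p], so monotonicity gives [0 <= '[p - z, r]] for every [z] in
    [Z], while [r] differs from [x - p] only by [g *: (B x - B p)], whose norm
    is at most [g * beta * `|x - p|]. Expanding squares, every step decreases
    the squared distance to each point of [Z] by at least a fixed multiple of
    [`|x - p| ^+ 2] ([tseng_step]).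

    The resolvent is nonexpansive, so the errors displace the iterate by at
    most a summable [e n], uniformly in [z]; below, [p n] is the error-free
    resolvent point, within [e n] of the perturbed one. The orbit is thus quasi-Fejer
    with respect to [Z]: its distance to each point of [Z] converges and
    [`|x n - p n| ^+ 2] is summable. Such an orbit converges weakly to a point
    of [Z] as soon as its weak cluster points lie in [Z] ([fejer_weak_cvg]),
    and it converges strongly when [Z] has an interior point
    ([fejer_interior_cvg]). The cluster points do lie in [Z] because the
    residuals [g^-1 *: r], which are values of [A + B] at the [p n], tend to
    [0], and the graph of [A + B] is weak-strong closed over [0]
    ([zer_add_weak_limit]). Demiregularity is tailored to this pair of
    sequences; uniform monotonicity compares the modulus of [`|x - p n|] with
    the inner product of [x - p n] and a vanishing residual
    ([uniformly_monotone_cvg]).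

    Two facts of Hilbert space theory carry the rest. Minty's theorem makes
    the resolvent everywhere defined, and the weak compactness of balls
    provides the cluster points. Both are obtained by minimizing a strongly
    convex function ([convex_minimizer]): half the squared norm plus the
    Fitzpatrick function of the operator for the former, half the squared norm
    plus a continuous linear form, which gives the Riesz representation, for
    the latter. Weak cluster points are taken along ultrafilters on [nat]
    rather than along subsequences: an ultrafilter gives at once a limit of
    ['[x n, v]] for all [v], without separability or a diagonal argument. *)

Set Implicit Arguments.
Unset Strict Implicit.
Unset Printing Implicit Defensive.

Import Order.TTheory GRing.Theory Num.Theory.
Import numFieldNormedType.Exports.

Local Open Scope classical_set_scope.
Local Open Scope ring_scope.

(** * Inner product *)

Section Inner.
Variables (R : realType) (H : hilbertType R).
Implicit Types (u v w : H) (k : R).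
Local Notation "''[' u , v ]" := (inner u%R v%R) : ring_scope.

Lemma innerC u v : '[u, v] = '[v, u].
Proof. by rewrite hermC /= expr0 mul1r. Qed.
Lemma innerDl u v w : '[u + v, w] = '[u, w] + '[v, w].
Proof. by rewrite linearDl. Qed.
Lemma innerBl u v w : '[u - v, w] = '[u, w] - '[v, w].
Proof. by rewrite linearBl. Qed.
Lemma innerNl u w : '[- u, w] = - '[u, w].
Proof. by rewrite linearNl. Qed.
Lemma innerZl k u v : '[k *: u, v] = k * '[u, v].
Proof. by rewrite linearZl_LR. Qed.
Lemma innerDr u v w : '[w, u + v] = '[w, u] + '[w, v].
Proof. by rewrite linearDr. Qed.
Lemma innerBr u v w : '[w, u - v] = '[w, u] - '[w, v].
Proof. by rewrite linearBr. Qed.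
Lemma innerNr u w : '[w, - u] = - '[w, u].
Proof. by rewrite linearNr. Qed.
Lemma innerZr k u v : '[u, k *: v] = k * '[u, v].
Proof. by rewrite innerC innerZl innerC. Qed.
Lemma inner0l u : '[0, u] = 0.
Proof. by rewrite linear0l. Qed.
Lemma inner0r u : '[u, 0] = 0.
Proof. by rewrite linear0r. Qed.
Lemma inner_self_ge0 u : 0 <= '[u, u].
Proof. by rewrite inner_norm sqr_ge0. Qed.
Lemma inner_self_eq0 u : '[u, u] = 0 -> u = 0.
Proof. by rewrite inner_norm => /eqP; rewrite sqrf_eq0 normr_eq0 => /eqP. Qed.

(** Reduces an identity between linear combinations of vectors to an identity
    in [R], where [ring] applies. *)
Lemma inner_ext u v : (forall w, '[u, w] = '[v, w]) -> u = v.
Proof.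
move=> uv; apply/eqP; rewrite -subr_eq0; apply/eqP/inner_self_eq0.
by rewrite innerBl uv subrr.
Qed.

Definition innerE := (innerDl, innerBl, innerNl, innerZl,
  innerDr, innerBr, innerNr, innerZr, inner0l, inner0r).

Lemma normBsq u v : `|u - v| ^+ 2 = `|u| ^+ 2 - 2 * '[u, v] + `|v| ^+ 2.
Proof. by rewrite -!inner_norm !innerE (innerC v u); ring. Qed.
Lemma normDsq u v : `|u + v| ^+ 2 = `|u| ^+ 2 + 2 * '[u, v] + `|v| ^+ 2.
Proof. by rewrite -!inner_norm !innerE (innerC v u); ring. Qed.

Lemma Cauchy_Schwarz u v : `|'[u, v]| <= `|u| * `|v|.
Proof.
rewrite -(@ler_pXn2r _ 2) ?nnegrE ?mulr_ge0 // real_normK ?num_real // exprMn.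
have [->|u0] := eqVneq u 0; first by rewrite inner0l normr0 !expr0n mul0r.
have up : 0 < `|u| ^+ 2 by rewrite exprn_gt0 // normr_gt0.
(* up to scaling, the component of v orthogonal to u *)
have := sqr_ge0 (`| `|u| ^+ 2 *: v - '[u, v] *: u|).
rewrite -inner_norm !innerE !inner_norm (innerC v u) => h.
rewrite -subr_ge0 -(pmulr_rge0 _ up); apply: le_trans h _.
by rewrite le_eqVlt; apply/orP; left; apply/eqP; ring.
Qed.
End Inner.

(** * Minimization of strongly convex functions *)

Section ConvexMin.
Variables (R : realType) (H : hilbertType R).
Local Notation "''[' u , v ]" := (inner u%R v%R) : ring_scope.

Lemma cvg_sqr_dist (x_ : nat -> H) (d : nat -> R) :
  d n @[n --> \oo] --> (0 : R) ->
  (forall i j, `|x_ i - x_ j| ^+ 2 <= d i + d j) -> cvg (x_ n @[n --> \oo]).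
Proof.
move=> d0 xd; apply/cauchy_cvgP/cauchy_exP => e e0.
have e2 : 0 < e ^+ 2 / 2 by rewrite divr_gt0 // exprn_gt0.
have [N _ dN] : \forall n \near \oo, d n < e ^+ 2 / 2 by exact: (cvgr_lt _ d0).
exists (x_ N); exists N => // n /= Nn; rewrite -ball_normE /ball_ /=.
rewrite -(@ltr_pXn2r _ 2) ?nnegrE ?normr_ge0 ?(ltW e0) //.
apply: le_lt_trans (xd N n) _.
have := dN N (leqnn N); have := dN n Nn; rewrite /= => h1 h2; lra.
Qed.

(** [E] plays the role of the epigraph of a closed convex function [f] of two
    variables, and [(x, u)] minimizes [f] plus half the squared norm. Since
    the latter is strongly convex, minimizing sequences are Cauchy by the
    parallelogram identity. The conclusion is the first-order optimality
    condition: [- (x, u)] is a subgradient of [f] at [(x, u)]. Working with an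
    epigraph spares extended values. *)
Lemma convex_minimizer (E : H -> H -> R -> Prop) (m : R) :
  (exists x u t, E x u t) ->
  (forall x u t x' u' t' l, 0 <= l <= 1 -> E x u t -> E x' u' t' ->
     E (x + l *: (x' - x)) (u + l *: (u' - u)) (t + l * (t' - t))) ->
  (forall (x_ u_ : nat -> H) (t_ : nat -> R) x u t,
     (forall n, E (x_ n) (u_ n) (t_ n)) -> x_ n @[n --> \oo] --> x ->
     u_ n @[n --> \oo] --> u -> t_ n @[n --> \oo] --> t -> E x u t) ->
  (forall x u t, E x u t -> m <= t + 2^-1 * (`|x| ^+ 2 + `|u| ^+ 2)) ->
  exists x u t, E x u t /\ forall x' u' t', E x' u' t' ->
    0 <= t' - t + '[x, x' - x] + '[u, u' - u].
Proof.
move=> [x0 [u0 [t0 E0]]] Econv Ecl Elb.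
pose V := [set v | exists x u t, E x u t /\
  v = t + 2^-1 * (`|x| ^+ 2 + `|u| ^+ 2)].
have Vinf : has_inf V.
  split; first by exists (t0 + 2^-1 * (`|x0| ^+ 2 + `|u0| ^+ 2)), x0, u0, t0.
  by exists m => _ [x [u [t [Et ->]]]]; exact: Elb Et.
have infV x u t : E x u t -> inf V <= t + 2^-1 * (`|x| ^+ 2 + `|u| ^+ 2).
  by move=> Et; apply: ge_inf; [case: Vinf | exists x, u, t].
have /choice [e He] n : exists e : H * H * R, E e.1.1 e.1.2 e.2 /\
    e.2 + 2^-1 * (`|e.1.1| ^+ 2 + `|e.1.2| ^+ 2) < inf V + n.+1%:R^-1.
  have [|_ [x [u [t [Et ->]]]] lt] := @inf_adherent _ V n.+1%:R^-1 _ Vinf.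
    by rewrite invr_gt0.
  by exists (x, u, t).
pose d n : R := 4 * n.+1%:R^-1.
have d0 : d n @[n --> \oo] --> (0 : R).
  rewrite -[X in _ --> X](mulr0 4); apply: cvgM; first exact: cvg_cst.
  exact: cvg_harmonic.
(* the midpoint of two almost minimizers cannot go below the infimum *)
have key i j : `|(e i).1.1 - (e j).1.1| ^+ 2 + `|(e i).1.2 - (e j).1.2| ^+ 2
    <= d i + d j.
  have [Ei vi] := He i; have [Ej vj] := He j.
  have l2 : 0 <= (2^-1 : R) <= 1 by apply/andP; split; lra.
  have := infV _ _ _ (Econv _ _ _ _ _ _ _ l2 Ei Ej).
  move: vi vj; rewrite /d -!inner_norm !innerE.
  rewrite (innerC (e j).1.1 (e i).1.1) (innerC (e j).1.2 (e i).1.2).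
  by move: (i.+1%:R^-1 : R) (j.+1%:R^-1 : R) => ri rj h1 h2 h3; lra.
have cx : cvg ((e n).1.1 @[n --> \oo]).
  apply: (cvg_sqr_dist d0) => i j; apply: le_trans (key i j).
  by rewrite lerDl sqr_ge0.
have cu : cvg ((e n).1.2 @[n --> \oo]).
  apply: (cvg_sqr_dist d0) => i j; apply: le_trans (key i j).
  by rewrite lerDr sqr_ge0.
set x := lim ((e n).1.1 @[n --> \oo]) in cx.
set u := lim ((e n).1.2 @[n --> \oo]) in cu.
pose t := inf V - 2^-1 * (`|x| ^+ 2 + `|u| ^+ 2).
have ct : (e n).2 @[n --> \oo] --> t.
  have sq : 2^-1 * (`|(e n).1.1| ^+ 2 + `|(e n).1.2| ^+ 2) @[n --> \oo] -->
     2^-1 * (`|x| ^+ 2 + `|u| ^+ 2).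
    apply: cvgM; first exact: cvg_cst.
    by apply: cvgD; (under eq_fun do rewrite expr2); rewrite expr2;
      apply: cvgM; apply: cvg_norm.
  have v : (e n).2 + 2^-1 * (`|(e n).1.1| ^+ 2 + `|(e n).1.2| ^+ 2)
      @[n --> \oo] --> inf V.
    apply: (@squeeze_cvgr _ _ _ _ (cst (inf V)) (fun n => inf V + n.+1%:R^-1)).
    - near=> n; have [En /ltW vn] := He n; rewrite vn andbT; exact: infV.
    - exact: cvg_cst.
    - rewrite -[X in _ --> X]addr0; apply: cvgD; first exact: cvg_cst.
      exact: cvg_harmonic.
  apply: cvg_trans (cvgB v sq); apply: near_eq_cvg; near=> n.
  by rewrite /= addrK.
have Et : E x u t by apply: Ecl cx cu ct => n; have [] := He n.
exists x, u, t; split=> // x' u' t' Et'.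
set alpha := _ + _ + _.
pose K := 2^-1 * (`|x' - x| ^+ 2 + `|u' - u| ^+ 2).
have K0 : 0 <= K by rewrite mulr_ge0 // addr_ge0 // sqr_ge0.
(* compare the minimizer with the point at parameter l on the segment towards
   (x', u', t'), and divide by l *)
have h l : 0 < l <= 1 -> 0 <= alpha + l * K.
  move=> /andP[l0 l1]; rewrite -(pmulr_rge0 _ l0).
  have l01 : 0 <= l <= 1 by rewrite ltW.
  have := infV _ _ _ (Econv _ _ _ _ _ _ _ l01 Et Et').
  rewrite /alpha /K {1}/t -!inner_norm !innerE.
  rewrite (innerC x' x) (innerC u' u) => hh; lra.
rewrite leNgt; apply/negP => a0.
pose l := Num.min 1 (- alpha / (2 * (K + 1))).
have K1 : 0 < K + 1 by lra.
have l0 : 0 < l by rewrite lt_min ltr01 /= divr_gt0 ?mulr_gt0 //; lra.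
have /h : 0 < l <= 1 by rewrite l0 ge_min lexx.
have : l * (2 * (K + 1)) <= - alpha.
  by rewrite -ler_pdivlMr ?mulr_gt0 // ge_min lexx orbT.
have : 0 <= l * K by rewrite mulr_ge0 // ltW.
by move=> h1 h2 h3; lra.
Unshelve. all: by end_near. Qed.

End ConvexMin.

(** * Riesz representation and weak compactness *)

Section Weak.
Variables (R : realType) (H : hilbertType R).
Local Notation "''[' u , v ]" := (inner u%R v%R) : ring_scope.

Lemma cvg_dist_le (T : Type) (F : set_system T) {FF : Filter F}
  (V : normedModType R) (f : T -> V) (g : T -> R) (l : V) :
  g t @[t --> F] --> (0 : R) -> (\forall t \near F, `|f t - l| <= g t) ->
  f t @[t --> F] --> l.
Proof.
move=> g0 fg; apply/cvgrPdist_lt => e e0.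
have ge : \forall t \near F, g t < e by exact: (cvgr_lt _ g0).
by near=> t; rewrite distrC; apply: (@le_lt_trans _ _ (g t)); near: t.
Unshelve. all: by end_near. Qed.

Lemma cvg_bounded_linear (T : Type) (F : set_system T) {FF : Filter F}
  (l : H -> R) (M : R) (f : T -> H) x :
  (forall u v, l (u - v) = l u - l v) -> (forall u, `|l u| <= M * `|u|) ->
  f t @[t --> F] --> x -> l (f t) @[t --> F] --> l x.
Proof.
move=> lB lM fx; apply: (@cvg_dist_le _ _ _ _ _ (fun t => M * `|f t - x|)).
  rewrite -[X in _ --> X](mulr0 M); apply: cvgM; first exact: cvg_cst.
  rewrite -(@normr0 _ H) -(subrr x); apply: cvg_norm.
  by apply: cvgB fx _; exact: cvg_cst.
by apply: nearW => t; rewrite -lB; exact: lM.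
Qed.

Lemma cvg_innerl (T : Type) (F : set_system T) {FF : Filter F}
  (f : T -> H) x v : f t @[t --> F] --> x -> '[f t, v] @[t --> F] --> '[x, v].
Proof.
apply: (@cvg_bounded_linear _ _ _ (fun u => '[u, v]) `|v|) => [u w|u].
  exact: innerBl.
by rewrite mulrC Cauchy_Schwarz.
Qed.

(** The minimizer of [l x] plus half of [`|x| ^+ 2] represents
    [- l]: [convex_minimizer] applies to the epigraph of [l], seen as a
    function of two variables that is constant in the second one. *)
Lemma riesz_representation (l : H -> R) (M : R) :
  (forall u v, l (u + v) = l u + l v) -> (forall k u, l (k *: u) = k * l u) ->
  (forall u, `|l u| <= M * `|u|) -> exists x, forall v, '[x, v] = l v.
Proof.
move=> lD lZ lM.
have lN u : l (- u) = - l u by rewrite -scaleN1r lZ mulN1r.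
have lB u v : l (u - v) = l u - l v by rewrite lD lN.
have [||||x [u [t [Et xmin]]]] :=
    @convex_minimizer R H (fun x _ t => l x <= t) (- (2^-1 * M ^+ 2)).
- by exists 0, 0, (l 0).
- move=> x _ t x' _ t' k /andP[k0 k1] h h'; rewrite lD lZ lB.
  rewrite -subr_ge0 in h; rewrite -subr_ge0 in h'.
  have := mulr_ge0 k0 h'; have : 0 <= (1 - k) * (t - l x).
    by rewrite mulr_ge0 // subr_ge0.
  by move=> h1 h2; lra.
- move=> x_ _ t_ x _ t h xc _ tc.
  apply: (ler_cvg_to (cvg_bounded_linear lB lM xc) tc).
  by apply: nearW.
- move=> x u t h.
  have := lM x; rewrite ler_norml => /andP[h1 _].
  have := sqr_ge0 (`|x| - M); have := sqr_ge0 `|u|.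
  by rewrite !expr2 => h2 h3; nra.
- have h v : - l v <= '[x, v].
    have := xmin (x + v) u (l (x + v)) (lexx _).
    by rewrite subrr inner0r addr0 [x + v]addrC addrK lD => h; lra.
  exists (- x) => v; apply/eqP; rewrite eq_le !innerNl.
  have := h v; have := h (- v); rewrite lN innerNr => h1 h2.
  by apply/andP; split; lra.
Qed.

Lemma ultra_bounded_cvg (T : Type) (U : set_system T) {UU : UltraFilter U}
  (f : T -> R) (M : R) : (forall t, `|f t| <= M) ->
  exists l : R, f t @[t --> U] --> l.
Proof.
move=> fM.
have fU : (f @ U) `[- M, M]%classic.
  by apply: nearW => t; rewrite /= in_itv /= -ler_norml.
have [l [_ lU]] := segment_compact (fmap_proper_filter f _) fU.
exists l => B Bl; have [//|UB] := in_ultra_setVsetC (f @^-1` B) UU.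
have [r [/=]] := lU (~` B) B UB Bl; by [].
Qed.

(** Weak compactness of balls: by compactness of segments, [U] assigns a limit
    to each bounded function [fun t => '[f t, v]]; these limits form a bounded
    linear form in [v], which is represented by a point. *)
Lemma bounded_ultra_weak_cvg (T : Type) (U : set_system T) {UU : UltraFilter U}
  (f : T -> H) (M : R) : (forall t, `|f t| <= M) ->
  exists x, forall v, '[f t, v] @[t --> U] --> '[x, v].
Proof.
move=> fM.
have fvM v t : `|'[f t, v]| <= M * `|v|.
  by apply: le_trans (Cauchy_Schwarz _ _) _; rewrite ler_wpM2r.
have /choice[l lE] : forall v, exists l : R, '[f t, v] @[t --> U] --> l.
  by move=> v; exact: ultra_bounded_cvg (fvM v).
have [||v|x xE] := @riesz_representation l M.
- move=> u v; apply: (cvg_unique _ (lE (u + v))) => //.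
  by rewrite /=; under eq_fun do rewrite innerDr; apply: cvgD.
- move=> k v; apply: (cvg_unique _ (lE (k *: v))) => //.
  rewrite /=; under eq_fun do rewrite innerZr.
  by apply: cvgM => //; exact: cvg_cst.
- have lv : `|'[f t, v]| @[t --> U] --> `|l v| by apply: cvg_norm.
  apply: (cvgr_to_le lv).
  by apply: nearW => t; exact: fvM.
- by exists x => v; rewrite xE.
Qed.
End Weak.

(** * Minty's theorem *)

Section Monotone.
Variables (R : realType) (H : hilbertType R).
Implicit Types (A : H -> set H) (x y u v p q : H).
Local Notation "''[' u , v ]" := (inner u%R v%R) : ring_scope.

(** Otherwise the graph could be extended by [(x, u)]. *)
Lemma max_monotone_related A x u : op_max_monotone A ->
  (forall a a', A a a' -> 0 <= '[x - a, u - a']) -> A x u.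
Proof.
move=> [Amon Amax] xu; apply: contrapT => nAxu; apply: Amax.
exists (fun z => [set w | A z w \/ (z = x /\ w = u)]); split.
  move=> z w z' w' /= [Az|[/= -> ->]] [Az'|[/= -> ->]].
  - exact: Amon.
  - by have := xu _ _ Az; rewrite -(opprB z) -(opprB w) innerNl innerNr opprK.
  - exact: xu.
  - by rewrite subrr inner0l.
split; first by case=> z w /= h; left.
by move=> /(_ (x, u)) h; apply: nAxu; apply: h; right.
Qed.

Lemma max_monotone_nonempty A : op_max_monotone A -> exists a a', A a a'.
Proof.
move=> Amax; apply: contrapT => A0; apply: (A0); exists 0, 0.
by apply: max_monotone_related => // a a' Aa; exfalso; apply: A0; exists a, a'.
Qed.

(** [E] is the epigraph of the Fitzpatrick function of [A], the supremum of
    ['[x, a'] + '[a, u] - '[a, a']] over the graph of [A]. It is convex and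
    closed; it dominates ['[x, u]] by maximality, and equals it on the graph
    by monotonicity. Hence its sum with half the squared norm is at least half
    of [`|x + u| ^+ 2], so it has a minimizer [(x, u)]. The optimality
    condition tested on the graph of [A] says that [(- u, - x)] is monotonically
    related to this graph, with the surplus [`|x + u| ^+ 2]; so [(- u, - x)]
    belongs to the graph and, testing against itself, the surplus vanishes. *)
Lemma minty_origin A : (exists a a', A a a') -> op_monotone A ->
  (forall x u, (forall a a', A a a' -> 0 <= '[x - a, u - a']) -> A x u) ->
  exists x, A x (- x).
Proof.
move=> [b [b' Ab]] Amon Amax.
pose E x u t := forall a a', A a a' -> '[x, a'] + '[a, u] - '[a, a'] <= t.
have E_graph a a' : A a a' -> E a a' '[a, a'].
  move=> Aa c c' Ac; have := Amon _ _ _ _ Aa Ac; rewrite !innerE => h; lra.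
have E_ge x u t : E x u t -> '[x, u] <= t.
  move=> Et; rewrite leNgt; apply/negP => lt.
  suff Axu : A x u by have := Et x u Axu => h; lra.
  apply: Amax => a a' Aa; have := Et _ _ Aa; rewrite !innerE => h; lra.
have [||||x [u [t [Et xmin]]]] := @convex_minimizer R H E 0.
- by exists b, b', '[b, b']; exact: E_graph.
- move=> x u t x' u' t' l /andP[l0 l1] h h' a a' Aa.
  have := h _ _ Aa; have := h' _ _ Aa; rewrite !innerE.
  rewrite -subr_ge0 => /(mulr_ge0 l0) h1.
  have l1' : 0 <= 1 - l by rewrite subr_ge0.
  by rewrite -subr_ge0 => /(mulr_ge0 l1') h2; lra.
- move=> x_ u_ t_ x u t Et xc uc tc a a' Aa.
  have xuc : '[x_ n, a'] + '[a, u_ n] - '[a, a'] @[n --> \oo] -->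
      '[x, a'] + '[a, u] - '[a, a'].
    apply: cvgB; last exact: cvg_cst.
    apply: cvgD; first exact: cvg_innerl.
    by under eq_fun do rewrite innerC; rewrite innerC; exact: cvg_innerl.
  by apply: (ler_cvg_to xuc tc); apply: nearW => n; exact: Et.
- move=> x u t /E_ge h; have := inner_self_ge0 (x + u).
  by rewrite -!inner_norm !innerE (innerC u x) => h1; lra.
have key a a' : A a a' -> '[x + u, x + u] <= '[- u - a, - x - a'].
  move=> Aa; have := xmin _ _ _ (E_graph _ _ Aa); have := E_ge _ _ _ Et.
  by rewrite !innerE !(innerC u x) (innerC a x) => h1 h2; lra.
have Aux : A (- u) (- x).
  by apply: Amax => a a' /key; apply: le_trans; exact: inner_self_ge0.
have /eqP : '[x + u, x + u] = 0.
  apply/eqP; rewrite eq_le inner_self_ge0 andbT.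
  by have := key _ _ Aux; rewrite subrr inner0l.
move=> /eqP /inner_self_eq0 /eqP; rewrite addr_eq0 => /eqP xE.
by exists x; rewrite {1}xE.
Qed.

(** The case of an arbitrary scaling and right-hand side follows by replacing
    [A] with the operator [g *: A - y], which is again maximally monotone. *)
Lemma minty_surjectivity A g y : op_max_monotone A -> 0 < g ->
  exists p, A p (g^-1 *: (y - p)).
Proof.
move=> Amax g0.
pose A' p := [set u | A p (g^-1 *: (u + y))].
have gV : 0 < g^-1 by rewrite invr_gt0.
have g1 : g^-1 * g = 1 by rewrite mulVf // gt_eqF.
have A'E a a' : A a a' -> A' a (g *: a' - y).
  by move=> Aa; rewrite /A' /= subrK scalerA g1 scale1r.
have [|||p Ap] := @minty_origin A'.
- have [a [a' Aa]] := max_monotone_nonempty Amax.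
  by exists a, (g *: a' - y); exact: A'E.
- move=> a a' c c' /= Aa Ac; have [Amon _] := Amax.
  have := Amon a (g^-1 *: (a' + y)) c (g^-1 *: (c' + y)) Aa Ac.
  by rewrite -scalerBr innerZr pmulr_rge0 // opprD addrACA subrr addr0.
- move=> x u xu; apply: (max_monotone_related Amax) => a a' Aa.
  have := xu _ _ (A'E _ _ Aa).
  rewrite -(pmulr_rge0 _ gV) -innerZr.
  by rewrite opprB addrA scalerBr scalerA g1 scale1r.
by exists p; move: Ap; rewrite /A' /= addrC.
Qed.

Lemma resolventP A g y : op_max_monotone A -> 0 < g ->
  A (resolvent (op_scale g A) y) (g^-1 *: (y - resolvent (op_scale g A) y)).
Proof.
move=> Amax g0; have [p Ap] := minty_surjectivity y Amax g0.
have g1 : g * g^-1 = 1 by rewrite mulfV // gt_eqF.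
have : op_inv (op_add (op_fun idfun) (op_scale g A)) y
    (resolvent (op_scale g A) y).
  apply: xgetPex; exists p, p => //.
  exists (y - p); last by rewrite addrC subrK.
  by exists (g^-1 *: (y - p)) => //; rewrite scalerA g1 scale1r.
case=> _ -> [_ [w Aw <-] yE]; move: Aw yE; move: (resolvent _ _) => r Aw /= <-.
by rewrite addrC addKr scalerA mulrC g1 scale1r.
Qed.

End Monotone.

(** * Series with bounded partial sums *)

Section BoundedSeries.
Variable R : realType.
Implicit Types (u v s e : nat -> R).

Definition bounded_series u := exists S, forall n, series u n <= S.

Lemma bounded_series_le u v : (forall n, u n <= v n) ->
  bounded_series v -> bounded_series u.
Proof.
move=> uv [S vS]; exists S => n; apply: le_trans (vS n).
by rewrite !seriesEnat /=; apply: ler_sum_nat => i _; exact: uv.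
Qed.

Lemma bounded_seriesD u v : bounded_series u -> bounded_series v ->
  bounded_series (fun n => u n + v n).
Proof.
move=> [S uS] [T vT]; exists (S + T) => n.
by have := lerD (uS n) (vT n); rewrite !seriesEnat /= big_split.
Qed.

Lemma bounded_seriesZ u k : 0 <= k -> bounded_series u ->
  bounded_series (fun n => k * u n).
Proof.
move=> k0 [S uS]; exists (k * S) => n.
rewrite seriesEnat /= -mulr_sumr ler_wpM2l //.
by have := uS n; rewrite seriesEnat.
Qed.

Lemma bounded_series_cvg u : (forall n, 0 <= u n) -> bounded_series u ->
  cvgn (series u).
Proof.
move=> u0 [S uS]; apply: nondecreasing_is_cvgn; last by exists S => _ [n _ <-].
by apply: nondecreasing_series => n _ _; exact: u0.
Qed.

Lemma bounded_series_cvg0 u : (forall n, 0 <= u n) -> bounded_series u ->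
  u n @[n --> \oo] --> (0 : R).
Proof. by move=> u0 /(bounded_series_cvg u0) /cvg_series_cvg_0. Qed.

Lemma bounded_seriesP u : (forall n, 0 <= u n) ->
  bounded_series u <-> (\sum_(0 <= n <oo) (u n)%:E < +oo)%E.
Proof.
move=> u0; have eu0 n : (0 <= (u n)%:E)%E by rewrite lee_fin.
split=> [[S uS]|sfin].
  apply: (@le_lt_trans _ _ S%:E); last exact: ltry.
  apply: lime_le; first by apply: is_cvg_nneseries => n _ _.
  apply: nearW => n; rewrite sumEFin lee_fin.
  by have := uS n; rewrite seriesEnat.
have sE : (\sum_(0 <= n <oo) (u n)%:E)%E \is a fin_num.
  by rewrite ge0_fin_numE // nneseries_ge0.
exists (fine (\sum_(0 <= n <oo) (u n)%:E)%E) => n.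
rewrite -lee_fin fineK // seriesEnat /= -sumEFin.
by apply: nneseries_lim_ge => k _ _.
Qed.

(** Telescoping: the total decrease of a nonnegative sequence is bounded by its
    initial value and its total increase. *)
Lemma almost_decreasing_series s d e : (forall n, 0 <= s n) ->
  (forall n, s n.+1 + d n <= s n + e n) -> bounded_series e -> bounded_series d.
Proof.
move=> s0 h [S eS]; exists (s 0%N + S) => n.
suff: series d n + s n <= s 0%N + series e n.
  by have := eS n; have := s0 n => h1 h2 h3; lra.
elim: n => [|n IH]; first by rewrite !seriesEnat /= !big_geq // add0r addr0.
rewrite !seriesSr; have := h n => h1; lra.
Qed.

Lemma almost_decreasing_cvg s e :
  (forall n, 0 <= s n) -> (forall n, 0 <= e n) ->
  (forall n, s n.+1 <= s n + e n) -> bounded_series e -> cvgn s.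
Proof.
move=> s0 e0 h eb; have [S eS] := eb.
have ce := bounded_series_cvg e0 eb.
have ct : cvgn (fun n => s n - series e n).
  apply: nonincreasing_is_cvgn.
    apply/nonincreasing_seqP => n; rewrite seriesSr; have := h n => h1; lra.
  exists (- S) => _ [n _ <-]; have := s0 n; have := eS n => h1 h2; lra.
have -> : s = (fun n => s n - series e n) \+ series e.
  by apply/funext => n /=; rewrite subrK.
exact: is_cvgD.
Qed.

Lemma almost_decreasing_bounded s e : (forall n, 0 <= e n) ->
  (forall n, s n.+1 <= s n + e n) -> bounded_series e ->
  exists M, forall n, s n <= M.
Proof.
move=> e0 h [S eS]; exists (s 0%N + S) => n.
suff: s n <= s 0%N + series e n by have := eS n => h1 h2; lra.
elim: n => [|n IH]; first by rewrite seriesEnat /= big_geq // addr0.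
rewrite seriesSr; have := h n => h1; lra.
Qed.

End BoundedSeries.

(** * Quasi-Fejer sequences *)

(** If [f] failed to converge along [F], some ultrafilter finer than [F] would
    avoid a neighborhood of [l]. *)
Lemma cvg_ultra (T : Type) (F : set_system T) (X : topologicalType)
  (f : T -> X) (l : X) : Filter F ->
  (forall U, UltraFilter U -> F `<=` U -> f @ U --> l) -> f @ F --> l.
Proof.
move=> FF h B Bl; apply: contrapT => nFB.
pose D := ~` (f @^-1` B).
have GP : ProperFilter (within D F).
  apply: Build_ProperFilter_ex => P FP; apply: contrapT => nP; apply: nFB.
  apply: (@filterS _ F _ _ _ _ FP) => t DPt; apply: contrapT => nBt.
  by apply: nP; exists t; exact: DPt.
have [U [UU GU]] := ultraFilterLemma GP.
have UB : U (f @^-1` B).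
  by apply: (h U UU) => // P FP; apply: GU; apply: (@filterS _ F _ P).
have UD : U D by apply: GU; exact: withinT.
by have [t [Bt /(_ Bt)]] := filter_ex (filterI UB UD).
Qed.

Section QuasiFejer.
Variables (R : realType) (H : hilbertType R).
Variables (C : set H) (x : nat -> H) (e : nat -> R).
Local Notation "''[' u , v ]" := (inner u%R v%R) : ring_scope.
Hypotheses (e_ge0 : forall n, 0 <= e n) (e_sum : bounded_series e).
Hypothesis fejer : forall z n, C z -> `|x n.+1 - z| <= `|x n - z| + e n.

Lemma fejer_cvg_dist z : C z -> cvgn (fun n => `|x n - z|).
Proof.
move=> Cz; apply: (almost_decreasing_cvg _ e_ge0 _ e_sum) => n //.
exact: fejer.
Qed.

Lemma fejer_bounded z : C z -> exists M, forall n, `|x n - z| <= M.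
Proof.
move=> Cz; apply: (almost_decreasing_bounded e_ge0 _ e_sum) => n.
exact: fejer.
Qed.

(** Opial's argument. Two weak cluster points [y] and [z] lie in [C], so the
    distances of [x n] to both converge, hence so does ['[x n, z - y]]. Its
    limit is both ['[z, z - y]] and ['[y, z - y]], so [z = y]; uniqueness of
    the cluster point gives weak convergence. *)
Lemma fejer_weak_cvg : C !=set0 ->
  (forall (U : set_system nat) z, UltraFilter U -> \oo `<=` U ->
     (forall v, '[x n, v] @[n --> U] --> '[z, v]) -> C z) ->
  exists2 z, C z & weak_cvg x z.
Proof.
move=> [z0 Cz0] clusterC; have [M0 xM0] := fejer_bounded Cz0.
have xM n : `|x n| <= M0 + `|z0|.
  rewrite -[x n](subrK z0); apply: le_trans (ler_normD _ _) _.
  by rewrite lerD2r.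
have weak (U : set_system nat) (UU : UltraFilter U) (sU : \oo `<=` U) :
    exists2 z, C z & forall v, '[x n, v] @[n --> U] --> '[z, v].
  have [z xz] := bounded_ultra_weak_cvg (U := U) xM.
  by exists z => //; exact: clusterC xz.
have [U0 [UU0 sU0]] := ultraFilterLemma (_ : ProperFilter \oo).
have [z Cz xz] := weak U0 UU0 sU0; exists z => // v.
apply: cvg_ultra => U UU sU; have [y Cy xy] := weak U UU sU.
suff -> : z = y by exact: xy.
apply/eqP; rewrite -subr_eq0; apply/eqP/inner_self_eq0.
have /cvg_ex[/= l xzyl] : cvgn (fun n => '[x n, z - y]).
  have -> : (fun n => '[x n, z - y]) = (fun n => 2^-1 * (`|x n - y| ^+ 2 -
      `|x n - z| ^+ 2 + (`|z| ^+ 2 - `|y| ^+ 2))).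
    by apply/funext => n; rewrite !normBsq innerBr; lra.
  apply: is_cvgM; first exact: is_cvg_cst.
  apply: is_cvgD; last exact: is_cvg_cst.
  by apply: is_cvgB; under eq_fun do rewrite expr2; apply: is_cvgM;
    exact: fejer_cvg_dist.
have lz : l = '[z, z - y].
  apply: (cvg_unique _ _ (xz _)) => //.
  exact: cvg_trans (cvg_app _ sU0) xzyl.
have ly : l = '[y, z - y].
  apply: (cvg_unique _ _ (xy _)) => //.
  exact: cvg_trans (cvg_app _ sU) xzyl.
by rewrite innerBl -lz -ly subrr.
Qed.

(** Let [C] contain the ball of radius [k] around [z0]. Apply the
    quasi-Fejer inequality at the point of this ball lying opposite to the
    increment [d = x n.+1 - x n]. Compared with the inequality at [z0], this
    adds the term [2 * k * `|d|] on the left. So the increments are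
    absolutely summable and the sequence is Cauchy. *)
Lemma fejer_interior_cvg : interior C !=set0 -> cvgn x.
Proof.
move=> [z0 /nbhs_ballP[r /= r0 rC]].
have Cz0 : C z0 by apply: rC; exact: ballxx.
have [M xM] := fejer_bounded Cz0; have [S eS] := e_sum.
pose k := r / 2; have k0 : 0 < k by rewrite divr_gt0.
have eS1 n : e n <= S.
  apply: le_trans (eS n.+1); rewrite seriesSr lerDr.
  by rewrite seriesEnat /= sumr_ge0.
have step n : `|x n.+1 - z0| ^+ 2 + 2 * k * `|x n.+1 - x n| <=
    `|x n - z0| ^+ 2 + (2 * (M + k) + S) * e n.
  set d := x n.+1 - x n.
  have M0 : 0 <= M by exact: le_trans (xM n).
  have [d0|d0] := eqVneq d 0.
    have -> : x n.+1 = x n by apply/eqP; rewrite -subr_eq0; apply/eqP.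
    rewrite d0 normr0 mulr0 addr0 lerDl mulr_ge0 //.
    by have := eS1 n; have := e_ge0 n => h1 h2; lra.
  have nd : 0 < `|d| by rewrite normr_gt0.
  pose w := (k / `|d|) *: d.
  have nw : `|w| = k.
    rewrite normrZ normrM normfV normr_id (gtr0_norm k0).
    by rewrite divfK // gt_eqF.
  have Cz : C (z0 - w).
    apply: rC; rewrite -ball_normE /ball_ /= opprB addrC subrK nw /k; lra.
  have fz := fejer n Cz.
  have zM : `|x n - (z0 - w)| <= M + k.
    rewrite opprB addrA addrAC; apply: le_trans (ler_normD _ _) _.
    by rewrite nw lerD2r.
  have sq : `|x n.+1 - (z0 - w)| ^+ 2 <=
      `|x n - (z0 - w)| ^+ 2 + (2 * (M + k) + S) * e n.
    have := eS1 n; have := e_ge0 n; move: fz zM.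
    move: (normr_ge0 (x n.+1 - (z0 - w))) (normr_ge0 (x n - (z0 - w))).
    move: `|x n.+1 - (z0 - w)| `|x n - (z0 - w)| (e n).
    move=> X Y t X0 Y0 h1 h2 h3 h4.
    by rewrite !expr2; nra.
  move: sq; rewrite opprB !addrA ![_ + w - z0]addrAC !normDsq.
  have -> : '[x n.+1 - z0, w] = '[x n - z0, w] + k * `|d|.
    rewrite [RHS]addrC; apply/eqP.
    rewrite -subr_eq -innerBl opprB addrA subrK -/d.
    by rewrite innerZr inner_norm expr2 mulrA divfK // gt_eqF.
  by move=> h; lra.
have : bounded_series (fun n => `|telescope x n|).
  have k20 : 0 < 2 * k by rewrite mulr_gt0.
  apply: (@bounded_series_le _ _
    (fun n => (2 * k)^-1 * (2 * k * `|x n.+1 - x n|))).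
    by move=> n; rewrite mulKf // gt_eqF.
  apply: bounded_seriesZ; first by rewrite invr_ge0 ltW.
  apply: (almost_decreasing_series _ step) => [n|]; first exact: sqr_ge0.
  apply: bounded_seriesZ => //.
  have := le_trans (normr_ge0 _) (xM 0%N).
  have := le_trans (e_ge0 0%N) (eS1 0%N).
  by move=> h1 h2; lra.
move=> /bounded_series_cvg => /(_ (fun=> normr_ge0 _)) /normed_cvg cx.
have -> : x = (fun n => x 0%N + series (telescope x) n).
  by apply/funext => n; exact: eq_sum_telescope.
by apply: is_cvgD => //; exact: is_cvg_cst.
Qed.

End QuasiFejer.

(** * The operator A + B and the forward-backward-forward step *)

Section SumOperator.
Variables (R : realType) (H : hilbertType R).
Variables (A : H -> set H) (B : H -> H) (beta : R).
Local Notation "''[' u , v ]" := (inner u%R v%R) : ring_scope.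
Hypotheses (A_max : op_max_monotone A) (B_mono : op_monotone (op_fun B)).
Hypothesis B_lip : forall u v, `|B u - B v| <= beta * `|u - v|.
Hypothesis beta_gt0 : 0 < beta.

Lemma A_monotone u u' v v' : A u u' -> A v v' -> 0 <= '[u - v, u' - v'].
Proof. by case: A_max => h _; exact: h. Qed.

Lemma B_monotone u v : 0 <= '[u - v, B u - B v].
Proof. exact: B_mono. Qed.

Lemma graph_addP p u : op_add A (op_fun B) p u <-> A p (u - B p).
Proof.
split=> [[v Av [_ -> <-]]|Ap]; first by rewrite addrK.
by exists (u - B p) => //; exists (B p) => //; rewrite subrK.
Qed.

Lemma zer_addP z : zer (op_add A (op_fun B)) z <-> A z (- B z).
Proof. by rewrite /zer /= -[- B z]add0r; exact: graph_addP. Qed.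

Lemma add_monotone p u q v : op_add A (op_fun B) p u ->
  op_add A (op_fun B) q v -> 0 <= '[p - q, u - v].
Proof.
move=> /graph_addP Ap /graph_addP Aq.
have := A_monotone Ap Aq; have := B_monotone p q.
by rewrite !innerE => h1 h2; lra.
Qed.

(** Passing to the limit in the monotonicity of [A + B] only gives
    ['[x - z, v] <= 0] for every [(z, v)] in its graph. The point [z] is then
    chosen with Minty's theorem as a resolvent of [A] at a forward step from
    [x], that is [v = (2 * beta) *: (x - z) - (B x - B z)]. The Lipschitz
    bound on [B] absorbs the last term, which forces [z = x] and [0] in
    [(A + B) x]. *)
Lemma zer_add_weak_limit (T : Type) (F : set_system T) {FF : ProperFilter F}
  (p u : T -> H) (M : R) x :
  (forall t, op_add A (op_fun B) (p t) (u t)) -> (forall t, `|p t| <= M) ->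
  (forall v, '[p t, v] @[t --> F] --> '[x, v]) ->
  u t @[t --> F] --> (0 : H) -> zer (op_add A (op_fun B)) x.
Proof.
move=> pu pM px u0.
have k0 : 0 < (2 * beta)^-1 by rewrite invr_gt0 mulr_gt0.
have [z Az] := minty_surjectivity (x - (2 * beta)^-1 *: B x) A_max k0.
rewrite invrK in Az; set w := (X in A z X) in Az.
have wE : w = (2 * beta) *: (x - z) - B x.
  by rewrite /w addrAC scalerBr scalerA mulfV ?scale1r // mulf_neq0 // gt_eqF.
have zw : op_add A (op_fun B) z (w + B z) by apply/graph_addP; rewrite addrK.
have lim0 : '[p t - z, u t] @[t --> F] --> (0 : R).
  apply: (@cvg_dist_le _ _ _ _ _ _ (fun t => (M + `|z|) * `|u t|)).
    rewrite -[X in _ --> X](mulr0 (M + `|z|)).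
    apply: cvgM; first exact: cvg_cst.
    by rewrite -(@normr0 _ H); apply: cvg_norm.
  apply: nearW => t; rewrite subr0; apply: le_trans (Cauchy_Schwarz _ _) _.
  by rewrite ler_wpM2r // (le_trans (ler_normB _ _)) // lerD2r.
have lim1 : '[p t - z, u t - (w + B z)] @[t --> F] --> 0 - '[x - z, w + B z].
  under eq_fun do rewrite innerBr; apply: cvgB => //.
  under eq_fun do rewrite innerBl; rewrite innerBl.
  by apply: cvgB; [exact: px|exact: cvg_cst].
have : 0 <= 0 - '[x - z, w + B z].
  by apply: (cvgr_to_ge lim1); apply: nearW => t; exact: add_monotone.
have := ler_norm '[x - z, B x - B z].
have := Cauchy_Schwarz (x - z) (B x - B z).
have := ler_wpM2l (normr_ge0 (x - z)) (B_lip x z).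
rewrite mulrCA -expr2 -inner_norm wE !innerDr innerZr !innerNr.
move=> h1 h2 h3 h4.
have /inner_self_eq0/eqP : '[x - z, x - z] = 0.
  apply/eqP; rewrite eq_le inner_self_ge0 andbT -(pmulr_rle0 _ beta_gt0); lra.
rewrite subr_eq0 => /eqP xz; apply/zer_addP.
by move: Az; rewrite wE -xz subrr scaler0 add0r.
Qed.

Lemma resolvent_nonexpansive g y y' : 0 < g ->
  `|resolvent (op_scale g A) y - resolvent (op_scale g A) y'| <= `|y - y'|.
Proof.
move=> g0; have := resolventP y' A_max g0; have := resolventP y A_max g0.
set p := resolvent _ y; set p' := resolvent _ y' => Ap Ap'.
have := A_monotone Ap Ap'; rewrite -scalerBr innerZr pmulr_rge0 ?invr_gt0 //.
move=> h0; have h : `|p - p'| ^+ 2 <= '[p - p', y - y'].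
  by move: h0; rewrite -inner_norm !innerE => h0; lra.
have [->|pp] := eqVneq `|p - p'| 0; first exact: normr_ge0.
have pp0 : 0 < `|p - p'| by rewrite lt_def pp normr_ge0.
rewrite -(ler_pM2l pp0) -expr2; apply: le_trans h _.
exact: le_trans (ler_norm _) (Cauchy_Schwarz _ _).
Qed.

(** The correction step makes [g^-1 *: r] an element of [(A + B) p], whence
    [0 <= '[p - z, r]], and makes [r] close to [x - p]: the difference is
    [g *: (B x - B p)]. The claim is the expansion of [`|(x - z) - r| ^+ 2]
    with these two facts. *)
Lemma tseng_step g x z p r : 0 < g -> zer (op_add A (op_fun B)) z ->
  A p (g^-1 *: (x - g *: B x - p)) ->
  r = (x - g *: B x) - (p - g *: B p) ->
  `|x - r - z| ^+ 2 + (1 - (g * beta) ^+ 2) * `|x - p| ^+ 2 <= `|x - z| ^+ 2.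
Proof.
move=> g0 /zer_addP Az Ap rE.
have pr : 0 <= '[p - z, r].
  have := A_monotone Ap Az; have := B_monotone p z.
  have -> : r = g *: (g^-1 *: (x - g *: B x - p) + B p).
    by rewrite rE scalerDr scalerA mulfV ?gt_eqF // scale1r opprD opprK addrA.
  move=> h1 h2; rewrite innerZr mulr_ge0 ?(ltW g0) //.
  by move: h1 h2; rewrite !innerBr !innerDr innerNr => h1 h2; lra.
have : `|r - (x - p)| ^+ 2 <= (g * beta) ^+ 2 * `|x - p| ^+ 2.
  have -> : r = (x - p) - g *: (B x - B p).
    by rewrite rE opprD addrACA -opprD scalerBr.
  rewrite addrAC subrr add0r normrN normrZ gtr0_norm // -exprMn.
  rewrite lerXn2r ?nnegrE ?mulr_ge0 ?(ltW g0) ?(ltW beta_gt0) //.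
  by rewrite -mulrA ler_wpM2l ?(ltW g0).
have -> : x - r - z = (x - z) - r by rewrite addrAC.
have : '[x - z, r] = '[x - p, r] + '[p - z, r].
  by rewrite -innerDl addrA subrK.
rewrite [`|r - _| ^+ 2]normBsq [`|_ - r| ^+ 2]normBsq (innerC r) => h1 h2; lra.
Qed.

End SumOperator.

(** * Convergence of the perturbed iteration *)

Lemma cvg_shift (R : realType) (V : normedModType R) (s t : nat -> V) (z : V) :
  `|s n - t n| @[n --> \oo] --> (0 : R) ->
  s n @[n --> \oo] --> z -> t n @[n --> \oo] --> z.
Proof.
move=> st sz; have -> : t = (fun n => s n - (s n - t n)).
  by apply/funext => n; rewrite subKr.
rewrite -[X in _ --> X]subr0; apply: cvgB => //.
by apply: (cvg_dist_le st); apply: nearW => n; rewrite subr0.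
Qed.

Lemma inner_cvg_shift (R : realType) (H : hilbertType R) (U : set_system nat)
    (s t : nat -> H) z v {FU : Filter U} : \oo `<=` U ->
  `|s n - t n| @[n --> \oo] --> (0 : R) ->
  inner (s n) v @[n --> U] --> inner z v ->
  inner (t n) v @[n --> U] --> inner z v.
Proof.
move=> sU st sz.
have -> : (fun n => inner (t n) v) =
    (fun n => inner (s n) v - inner (s n - t n) v).
  by apply/funext => n; rewrite innerBl subKr.
rewrite -[X in _ --> X]subr0; apply: cvgB => //.
have : inner (s n - t n) v @[n --> \oo] --> (0 : R).
  apply: (@cvg_dist_le _ _ _ _ _ _ (fun n => `|s n - t n| * `|v|)).
    by rewrite -[X in _ --> X](mul0r `|v|); apply: cvgM => //; exact: cvg_cst.
  by apply: nearW => n; rewrite subr0 Cauchy_Schwarz.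
exact: cvg_trans (cvg_app _ sU).
Qed.

Lemma cvg_sqr_0 (R : realType) (s : nat -> R) :
  s n ^+ 2 @[n --> \oo] --> (0 : R) -> s n @[n --> \oo] --> (0 : R).
Proof.
move=> s0; apply/cvgrPdist_lt => d d0.
have d2 : 0 < d ^+ 2 by rewrite exprn_gt0.
apply: filterS (cvgr_lt _ s0 _ d2) => n.
by rewrite sub0r normrN -ltr_sqrt // sqrtr_sqr sqrtr_sqr (gtr0_norm d0).
Qed.

(** A modulus is bounded away from [0] outside any neighborhood of [0]. It may
    take the value [+oo] there, whence the case analysis. *)
Lemma modulus_cvg0 (R : realType) (phi : R -> \bar R) (s g : nat -> R) :
  (forall r, 0 <= r -> (0 <= phi r)%E) ->
  (forall r t, 0 <= r -> r <= t -> (phi r <= phi t)%E) ->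
  (forall r, 0 <= r -> (phi r = 0%E <-> r = 0)) ->
  (forall n, 0 <= s n) -> (forall n, (phi (s n) <= (g n)%:E)%E) ->
  g n @[n --> \oo] --> (0 : R) -> s n @[n --> \oo] --> (0 : R).
Proof.
move=> phi0 phi_mono phi_eq0 s0 phig g0; apply/cvgrPdist_lt => d d0.
have phid : (0 < phi d)%E.
  rewrite lt_def phi0 ?(ltW d0) // andbT; apply/eqP => /phi_eq0 dE.
  by have := d0; rewrite (dE (ltW d0)) ltxx.
have : \forall n \near \oo, ((g n)%:E < phi d)%E.
  case: (phi d) phid => [r| |] //=.
    rewrite lte_fin => r0; apply: filterS (cvgr_lt _ g0 _ r0) => n.
    by rewrite lte_fin.
  by move=> _; apply: nearW => n; exact: ltry.
apply: filterS => n gn; rewrite sub0r normrN ger0_norm // ltNge.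
apply/negP => sd.
have := le_lt_trans (phig n) gn.
by rewrite ltNge phi_mono // ltW.
Qed.

(** Whichever of [A] and [B] is uniformly monotone at [x], adding the plain
    monotonicity of the other bounds the modulus of [`|x - p n|] by
    [- '[x - p n, u n]], which vanishes in the limit. *)
Lemma uniformly_monotone_cvg (R : realType) (H : hilbertType R)
  (A : H -> set H) (B : H -> H) (p u : nat -> H) (M : R) x :
  op_monotone A -> op_monotone (op_fun B) ->
  uniformly_monotone A x \/ uniformly_monotone (op_fun B) x ->
  zer (op_add A (op_fun B)) x ->
  (forall n, op_add A (op_fun B) (p n) (u n)) -> (forall n, `|p n| <= M) ->
  u n @[n --> \oo] --> (0 : H) -> p n @[n --> \oo] --> x.
Proof.
move=> A_mono B_mono unif /graph_addP; rewrite sub0r => Ax pu pM u0.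
have Ap n : A (p n) (u n - B (p n)) by have /graph_addP := pu n.
have Amono n : 0 <= inner (x - p n) (- B x - (u n - B (p n))).
  exact: A_mono (Ax : gra A (x, - B x)) (Ap n).
have Bmono n : 0 <= inner (x - p n) (B x - B (p n)) by exact: B_mono.
have [phi [phi0 phi_mono phi_eq0 phi_le]] : exists phi : R -> \bar R,
    [/\ forall s : R, 0 <= s -> (0 <= phi s)%E,
        forall s t : R, 0 <= s -> s <= t -> (phi s <= phi t)%E,
        forall s : R, 0 <= s -> (phi s = 0%E <-> s = 0) &
        forall n, (phi `|x - p n|%R <= (- inner (x - p n) (u n))%R%:E)%E].
  case: unif => -[_ [phi [phi0 phi_mono phi_eq0 phi_le]]];
    exists phi; split=> // n.
    apply: le_trans (phi_le _ _ _ Ax (Ap n)) _; rewrite lee_fin.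
    by have := Bmono n; rewrite !innerBr innerNr => h; lra.
  apply: le_trans (phi_le (B x) (p n) (B (p n)) erefl erefl) _; rewrite lee_fin.
  by have := Amono n; rewrite !innerBr innerNr => h; lra.
apply: (@cvg_dist_le _ _ _ _ _ _ (fun n => `|x - p n|)); last first.
  by apply: nearW => n; rewrite distrC.
apply: (modulus_cvg0 phi0 phi_mono phi_eq0 _ phi_le) => //.
apply: (@cvg_dist_le _ _ _ _ _ _ (fun n => (`|x| + M) * `|u n|)).
  rewrite -[X in _ --> X](mulr0 (`|x| + M)); apply: cvgM; first exact: cvg_cst.
  by rewrite -(@normr0 _ H); apply: cvg_norm.
apply: nearW => n; rewrite subr0 normrN; apply: le_trans (Cauchy_Schwarz _ _) _.
by rewrite ler_wpM2r // (le_trans (ler_normB _ _)) // lerD2l.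
Qed.

Unset Implicit Arguments.

Theorem theorem2p5 (R : realType) (H : hilbertType R)
    (A : H -> set H) (B : H -> H) (beta : R)
    (a b c x y p q : nat -> H) (eps : R) (gamma : nat -> R)
    (A_max : op_max_monotone A)
    (B_mono : op_monotone (op_fun B))
    (zerAB : zer (op_add A (op_fun B)) !=set0)
    (beta_gt0 : 0 < beta)
    (B_lip : beta.-lipschitz B)
    (a_sum : (\sum_(0 <= n <oo) `|a n|%:E < +oo)%E)
    (b_sum : (\sum_(0 <= n <oo) `|b n|%:E < +oo)%E)
    (c_sum : (\sum_(0 <= n <oo) `|c n|%:E < +oo)%E)
    (eps_range : 0 < eps < 1 / (beta + 1))
    (gamma_range : forall n, eps <= gamma n <= (1 - eps) / beta)
    (yE : forall n, y n = x n - gamma n *: (B (x n) + a n))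
    (pE : forall n, p n = resolvent (op_scale (gamma n) A) (y n) + b n)
    (qE : forall n, q n = p n - gamma n *: (B (p n) + c n))
    (xE : forall n, x n.+1 = x n - y n + q n) :
  exists xbar : H,
    [/\ zer (op_add A (op_fun B)) xbar,
        (\sum_(0 <= n <oo) (`|x n - p n| ^+ 2)%:E < +oo)%E /\
        (\sum_(0 <= n <oo) (`|y n - q n| ^+ 2)%:E < +oo)%E,
        weak_cvg x xbar /\ weak_cvg p xbar &
        [\/ demiregular (op_add A (op_fun B)) xbar,
            uniformly_monotone A xbar \/ uniformly_monotone (op_fun B) xbar |
            interior (zer (op_add A (op_fun B))) !=set0] ->
        x n @[n --> \oo] --> xbar /\ p n @[n --> \oo] --> xbar].
Proof.
move: eps_range => /andP[eps0 epsb].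
have Blip u v : `|B u - B v| <= beta * `|u - v| by exact: (B_lip (u, v)).
have g_ge n : eps <= gamma n by have /andP[] := gamma_range n.
have g0 n : 0 < gamma n by exact: lt_le_trans (g_ge n).
have gb n : gamma n * beta <= 1 - eps.
  by have /andP[_] := gamma_range n; rewrite ler_pdivlMr.
have gbV n : gamma n <= beta^-1.
  by rewrite -[beta^-1]mul1r ler_pdivlMr //; have := gb n => h; lra.
have bV0 : 0 < beta^-1 by rewrite invr_gt0.
have eps1 : eps < 1.
  apply: lt_trans epsb _; rewrite ltr_pdivrMr ?addr_gt0 //; lra.
(* pt, r and u are what p, x n - x n.+1 and the residual would be without
   errors at step n *)
pose pt n := resolvent (op_scale (gamma n) A) (x n - gamma n *: B (x n)).
pose r n := (x n - gamma n *: B (x n)) - (pt n - gamma n *: B (pt n)).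
pose u n := (gamma n)^-1 *: r n.
(* the errors displace pt by at most beta^-1 * `|a n| + `|b n|; the second
   forward step at most doubles this, and each forward step adds its own error,
   all of this with gamma n <= beta^-1 *)
pose e n := 3 * beta^-1 * `|a n| + (2 * `|b n| + beta^-1 * `|c n|).
pose Z := zer (op_add A (op_fun B)).
have Apt n : A (pt n) ((gamma n)^-1 *: (x n - gamma n *: B (x n) - pt n)).
  exact: resolventP.
have Au n : op_add A (op_fun B) (pt n) (u n).
  apply/graph_addP; have -> : u n - B (pt n) =
      (gamma n)^-1 *: (x n - gamma n *: B (x n) - pt n) => //.
  rewrite /u /r opprD opprK addrA scalerDr scalerA mulVf ?gt_eqF //.
  by rewrite scale1r addrK.
have e0 n : 0 <= e n by rewrite /e !addr_ge0 // !mulr_ge0 // ltW.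
have eb : bounded_series e.
  by apply: bounded_seriesD; last apply: bounded_seriesD;
    (apply: bounded_seriesZ;
      [by rewrite ?mulr_ge0 // ltW | exact/bounded_seriesP]).
have [S eS] := eb.
have e_le n : e n <= S.
  apply: le_trans (eS n.+1); rewrite seriesSr lerDr.
  by rewrite seriesEnat /= sumr_ge0.
have ga n : `|gamma n *: a n| <= beta^-1 * `|a n|.
  by rewrite normrZ gtr0_norm // ler_wpM2r.
have gc n : `|gamma n *: c n| <= beta^-1 * `|c n|.
  by rewrite normrZ gtr0_norm // ler_wpM2r.
have gB n v w : `|gamma n *: (B v - B w)| <= `|v - w|.
  rewrite normrZ gtr0_norm // (le_trans (ler_wpM2l (ltW (g0 n)) (Blip v w))) //.
  by rewrite mulrA ler_piMl //; have := gb n => h; lra.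
(* the resolvent is nonexpansive, so only the error on the forward step and b
   separate p from the exact resolvent step pt *)
have ppt n : `|p n - pt n| <= beta^-1 * `|a n| + `|b n|.
  rewrite pE addrAC; apply: le_trans (ler_normD _ _) _; rewrite lerD2r.
  apply: le_trans (resolvent_nonexpansive A_max _ _ (g0 n)) _.
  have -> : y n - (x n - gamma n *: B (x n)) = - (gamma n *: a n).
    by apply: inner_ext => w; rewrite yE !innerE; ring.
  by rewrite normrN.
have ppte n : `|p n - pt n| <= e n.
  apply: le_trans (ppt n) _; rewrite /e.
  have := mulr_ge0 (ltW bV0) (normr_ge0 (a n)).
  have := mulr_ge0 (ltW bV0) (normr_ge0 (c n)); have := normr_ge0 (b n).
  by move=> h1 h2 h3; lra.
have xr n : `|x n.+1 - (x n - r n)| <= e n.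
  have -> : x n.+1 - (x n - r n) = gamma n *: a n + (p n - pt n)
       - gamma n *: (B (p n) - B (pt n)) - gamma n *: c n.
    by apply: inner_ext => w; rewrite xE qE yE /r !innerE; ring.
  apply: le_trans (ler_normB _ _) _.
  have := ler_normB (gamma n *: a n + (p n - pt n))
    (gamma n *: (B (p n) - B (pt n))).
  have := ler_normD (gamma n *: a n) (p n - pt n).
  have := ga n; have := gc n; have := gB n (p n) (pt n); have := ppt n.
  rewrite /e.
  by move=> h1 h2 h3 h4 h5 h6; lra.
have step z n : Z z ->
    `|x n - r n - z| ^+ 2 + eps ^+ 2 * `|x n - pt n| ^+ 2 <= `|x n - z| ^+ 2.
  move=> Zz.
  have := tseng_step A_max B_mono Blip beta_gt0 (g0 n) Zz (Apt n) erefl.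
  apply: le_trans; rewrite lerD2l ler_wpM2r ?sqr_ge0 //.
  have := gb n; have := mulr_ge0 (ltW (g0 n)) (ltW beta_gt0).
  by rewrite !expr2 => h1 h2; nra.
have nstep z n : Z z -> `|x n - r n - z| <= `|x n - z|.
  move=> Zz; rewrite -(@ler_pXn2r _ 2) ?nnegrE //.
  apply: le_trans (step z n Zz).
  by rewrite lerDl mulr_ge0 // sqr_ge0.
have tri z n : `|x n.+1 - z| <= `|x n - r n - z| + e n.
  rewrite -[x n.+1](subrK (x n - r n)) -addrA addrC.
  by apply: le_trans (ler_normD _ _) _; rewrite lerD2l.
have fejer z n : Z z -> `|x n.+1 - z| <= `|x n - z| + e n.
  by move=> Zz; apply: le_trans (tri z n) _; rewrite lerD2r nstep.
have [z0 Zz0] := zerAB.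
have [M xM] := fejer_bounded e0 eb fejer Zz0.
have M0 : 0 <= M by exact: le_trans (xM 0%N).
have S0 : 0 <= S by exact: le_trans (e_le 0%N).
(* squaring the triangle inequality costs a multiple of e n, because the
   orbit stays at distance at most M from z0 and e n at most S *)
have dsum : bounded_series (fun n => `|x n - pt n| ^+ 2).
  have e2 : 0 < eps ^+ 2 by rewrite exprn_gt0.
  apply: (@bounded_series_le _ _
      (fun n => (eps ^+ 2)^-1 * (eps ^+ 2 * `|x n - pt n| ^+ 2))).
    by move=> n; rewrite mulKf // gt_eqF.
  apply: bounded_seriesZ; first by rewrite invr_ge0 ltW.
  apply: (@almost_decreasing_series _ (fun n => `|x n - z0| ^+ 2) _
     (fun n => (2 * M + S) * e n)) => [n|n|]; first exact: sqr_ge0.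
    have := step z0 n Zz0; have := nstep z0 n Zz0; have := tri z0 n.
    have := xM n; have := e_le n; have := e0 n.
    have := normr_ge0 (x n.+1 - z0); have := normr_ge0 (x n - r n - z0).
    move: (eps ^+ 2 * _) => w.
    move: `|x n.+1 - z0| `|x n - r n - z0| `|x n - z0| (e n) => X Y W t.
    by rewrite !expr2 => *; nra.
  by apply: bounded_seriesZ => //; lra.
have d0 : `|x n - pt n| @[n --> \oo] --> (0 : R).
  by apply: cvg_sqr_0; apply: bounded_series_cvg0 dsum => n; exact: sqr_ge0.
have es0 : e n @[n --> \oo] --> (0 : R) by exact: bounded_series_cvg0.
have rd n : `|r n| <= 2 * `|x n - pt n|.
  have -> : r n = (x n - pt n) - gamma n *: (B (x n) - B (pt n)).
    by rewrite /r opprD addrACA -opprD scalerBr.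
  apply: le_trans (ler_normB _ _) _; have := gB n (x n) (pt n) => h; lra.
have u0 : u n @[n --> \oo] --> (0 : H).
  apply: (@cvg_dist_le _ _ _ _ _ _ (fun n => eps^-1 * 2 * `|x n - pt n|)).
    rewrite -[X in _ --> X](mulr0 (eps^-1 * 2)).
    by apply: cvgM => //; exact: cvg_cst.
  apply: nearW => n; rewrite subr0 normrZ gtr0_norm ?invr_gt0 // -mulrA.
  by apply: ler_pM => //; rewrite ?invr_ge0 ?lef_pV2 ?posrE // ltW.
have xp0 : `|x n - p n| @[n --> \oo] --> (0 : R).
  apply: (@cvg_dist_le _ _ _ _ _ _ (fun n => `|x n - pt n| + e n)).
    by rewrite -[X in _ --> X](addr0 0); exact: cvgD.
  apply: nearW => n; rewrite subr0 normr_id.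
  apply: le_trans (ler_distD (pt n) _ _) _.
  by rewrite lerD2l distrC.
have [K ptK] : exists K, forall n, `|pt n| <= K.
  have [D [_ xptD]] : bounded_fun (fun n => `|x n - pt n|).
    by apply: cvg_seq_bounded; apply/cvg_ex; exists 0.
  exists (D + 1 + (M + `|z0|)) => n.
  have D1 : D < D + 1 by rewrite ltrDl.
  have := xptD _ D1 n I; rewrite /= normr_id => h.
  have -> : pt n = (x n - z0) + z0 - (x n - pt n) by rewrite subrK subKr.
  apply: le_trans (ler_normB _ _) _; rewrite addrC lerD //.
  by apply: le_trans (ler_normD _ _) _; rewrite lerD2r.
have cluster (U : set_system nat) z : UltraFilter U -> \oo `<=` U ->
    (forall v, inner (x n) v @[n --> U] --> inner z v) -> Z z.
  move=> UU sU xz.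
  apply: (zer_add_weak_limit (F := U) A_max B_mono Blip beta_gt0 Au ptK).
    by move=> v; exact: inner_cvg_shift sU d0 (xz v).
  exact: cvg_trans (cvg_app _ sU) u0.
have [xbar Zx xw] := fejer_weak_cvg e0 eb fejer zerAB cluster.
exists xbar; split=> //.
- split; apply/bounded_seriesP => [n|]; rewrite ?sqr_ge0 //.
    apply: (@bounded_series_le _ _
       (fun n => 2 * `|x n - pt n| ^+ 2 + 2 * S * e n)) => [n|].
      have : `|x n - p n| <= `|x n - pt n| + e n.
        by apply: le_trans (ler_distD (pt n) _ _) _; rewrite lerD2l distrC.
      have := e_le n; have := e0 n; have := normr_ge0 (x n - p n).
      have := normr_ge0 (x n - pt n).
      move: `|x n - p n| `|x n - pt n| (e n) => X Y t h1 h2 h3 h4 h5.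
      have := sqr_ge0 (Y - t); rewrite !expr2 => h6; nra.
    by apply: bounded_seriesD; apply: bounded_seriesZ => //; rewrite mulr_ge0.
  apply: (@bounded_series_le _ _
     (fun n => 8 * `|x n - pt n| ^+ 2 + 2 * S * e n)) => [n|].
    have : `|y n - q n| <= 2 * `|x n - pt n| + e n.
      have -> : y n - q n = r n - (x n.+1 - (x n - r n)).
        by apply: inner_ext => w; rewrite xE !innerE; ring.
      by apply: le_trans (ler_normB _ _) _; exact: lerD.
    have := e_le n; have := e0 n; have := normr_ge0 (y n - q n).
    have := normr_ge0 (x n - pt n).
    move: `|y n - q n| `|x n - pt n| (e n) => X Y t h1 h2 h3 h4 h5.
    have := sqr_ge0 (2 * Y - t); rewrite !expr2 => h6; nra.
  by apply: bounded_seriesD; apply: bounded_seriesZ => //; rewrite mulr_ge0.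
- by split=> // v; exact: inner_cvg_shift _ xp0 (xw v).
move=> cases.
suff xx : x n @[n --> \oo] --> xbar by split=> //; exact: cvg_shift xp0 xx.
have ptx : pt n @[n --> \oo] --> xbar -> x n @[n --> \oo] --> xbar.
  by apply: cvg_shift; under eq_fun do rewrite distrC.
case: cases => [[_ demi]|unif|int].
- apply: ptx; apply: (demi pt u 0) => // v; exact: inner_cvg_shift _ d0 (xw v).
- apply: ptx; have [A_mono _] := A_max.
  exact: uniformly_monotone_cvg unif Zx Au ptK u0.
- have /cvg_ex[/= l xl] := fejer_interior_cvg e0 eb fejer int.
  suff -> : xbar = l by [].
  apply/eqP; rewrite -subr_eq0; apply/eqP/inner_self_eq0; rewrite innerBl.
  apply/eqP; rewrite subr_eq0; apply/eqP.
  by apply: (cvg_unique _ (xw (xbar - l))) => //; exact: cvg_innerl.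
Qed.
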